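(* Let $\mathfrak g=\mathbb R b\ltimes_D\mathfrak h$ be an $(n+1)$-dimensional almost abelian real Lie algebra with inner product $g$, where $\mathfrak h$ is a codimension-one abelian ideal, $b\perp\mathfrak h$ is a unit vector and $D=\mathrm{ad}_b|_{\mathfrak h}$. Let $p\ge 0$, $r=\lfloor p/2\rfloor$, let $K\in \mathrm{Sym}^p(\mathfrak g)$, and write (uniquely) $$K=\sum_{0\le i\le r}L^i\cdot(\alpha_i\cdot b+\beta_i),\qquad \alpha_i\in\mathrm{Sym}^{p-2i-1}(\mathfrak h),\ \beta_i\in \mathrm{Sym}^{p-2i}(\mathfrak h),$$ and set $K^{o}:=b\cdot\sum_{0\le i\le r}L^i\cdot\alpha_i$ and $K^{e}:=\sum_{0\le i\le r}L^i\cdot\beta_i$, so that $K=K^o+K^e$. Then: (1) $K^e$ is Killing if and only if $\beta_i$ is Killing for all $i=0,\dots,r$. (2) If $D$ is skew-symmetric, then $K^o$ is Killing if and only if $\alpha_i$ is Killing for all $i=0,\dots,r$. (3) If $D$ is not skew-symmetric, then $K^o$ is Killing if and only if $K^o=0$.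
   Context: An almost abelian Lie algebra is a finite-dimensional real Lie algebra with an abelian ideal $\mathfrak h$ of codimension 1. Given an inner product $g$ on $\mathfrak g$ and a unit vector $b\perp\mathfrak h$, put $D:=\mathrm{ad}_b|_{\mathfrak h}:\mathfrak h\to\mathfrak h$; then $\mathfrak g\cong\mathbb R b\ltimes_D\mathfrak h$. Skew-symmetry of $D$ is with respect to $g$. For a vector space $V$, $\mathrm{Sym}^p(V)\subset V^{\otimes p}$ is spanned by the symmetric products $v_1\cdot\ldots\cdot v_p:=\sum_{\sigma\in\mathfrak S_p}v_{\sigma(1)}\otimes\ldots\otimes v_{\sigma(p)}$; $\mathrm{Sym}^0(V)=\mathbb R$, and $\mathrm{Sym}^{-1}(V):=0$. The symmetric product makes $\mathrm{Sym}^\bullet(V)$ the (commutative, associative) symmetric algebra of $V$. $\mathrm{Sym}^\bullet(\mathfrak h)$ is regarded inside $\mathrm{Sym}^\bullet(\mathfrak g)$. With $\{h_1,\dots,h_n\}$ an orthonormal basis of $\mathfrak h$, $L:=b\cdot b+\sum_{i=1}^n h_i\cdot h_i\in\mathrm{Sym}^2(\mathfrak g)$. Every $K\in \mathrm{Sym}^p(\mathfrak g)$ has a unique expression of the form displayed in the claim. Killing condition: let $G$ be a connected Lie group with Lie algebra $\mathfrak g$ and the left-invariant Riemannian metric defined by $g$, with Levi-Civita connection $\nabla$. The Killing operator on a Riemannian manifold $M$ is $\mathrm d:\Gamma(\mathrm{Sym}^pTM)\to\Gamma(\mathrm{Sym}^{p+1}TM)$, $\mathrm d(K)=\sum_i e_i\cdot\nabla_{e_i}K$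 for a local orthonormal frame $\{e_i\}$; $K$ is Killing if $\mathrm d(K)=0$. Elements of $\mathrm{Sym}^p(\mathfrak g)$ are identified with left-invariant symmetric $p$-tensors on $G$; an element of $\mathrm{Sym}^p(\mathfrak g)$ is called Killing if the corresponding left-invariant tensor field is Killing. *)

(* Defs.v *)
From HB Require Import structures.
From mathcomp Require Import all_boot all_order all_algebra.
From mathcomp Require Import sesquilinear.
From mathcomp Require Import reals.
From mathcomp Require Import mpoly.
From mathcomp Require Import ring lra.

Set Implicit Arguments.
Unset Strict Implicit.
Unset Printing Implicit Defensive.

Import Order.TTheory GRing.Theory Num.Theory.
Local Open Scope ring_scope.

Section LieAlgebra.
Variables (R : realType) (V : vectType R).

Record is_lie_bracket (br : {bilinear V -> V -> V}) : Prop := IsLieBracket {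
  lie_alternating : forall x, br x x = 0;
  lie_jacobi : forall x y z, br x (br y z) + br y (br z x) + br z (br x y) = 0
}.

Record is_codim1_abelian_ideal (br : {bilinear V -> V -> V}) (h : {vspace V})
    : Prop := IsCodim1AbelianIdeal {
  ideal_stable : forall x y, y \in h -> br x y \in h;
  ideal_abelian : {in h &, forall x y, br x y = 0};
  ideal_codim1 : \dim {:V} = (\dim h).+1
}.

Definition is_orthonormal_basis (g : {dot V for @idfun R}) (U : {vspace V})
    (m : nat) (e : m.-tuple V) : Prop :=
  basis_of U e /\ forall i j, g (tnth e i) (tnth e j) = (i == j)%:R.

Definition is_skew_on (g : {dot V for @idfun R}) (U : {vspace V})
    (D : V -> V) : Prop :=
  {in U &, forall x y, g (D x) y = - g x (D y)}.

(* The Levi-Civita connection of the left-invariant metric g, on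
   left-invariant vector fields: the torsion-free metric connection. The
   functions g(y, z) are constant for left-invariant y and z, so that
   compatibility with the metric has no term x(g(y, z)). *)
Record is_levi_civita (br : {bilinear V -> V -> V}) (g : {dot V for @idfun R})
    (nabla : {bilinear V -> V -> V}) : Prop := IsLeviCivita {
  torsion_free : forall x y, nabla x y - nabla y x = br x y;
  metric_compatible : forall x y z, g (nabla x y) z + g y (nabla x z) = 0
}.

End LieAlgebra.

(* The symmetric algebra of a space with orthonormal basis e_0, ..., e_{m-1} is
   represented by the polynomial algebra {mpoly R[m]}: the indeterminate 'X_i
   is e_i, and the symmetric product of vectors is the product of
   polynomials. *)
Section SymmetricAlgebra.
Variables (R : realType) (V : vectType R) (g : {dot V for @idfun R}).
Variables (m : nat) (e : m.-tuple V).

Definition sym_vec (v : V) : {mpoly R[m]} :=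
  \sum_(i < m) g v (tnth e i) *: 'X_i.

(* The extension of nabla_x to symmetric tensors as a derivation. *)
Definition sym_nabla (nabla : {bilinear V -> V -> V}) (x : V)
    (K : {mpoly R[m]}) : {mpoly R[m]} :=
  \sum_(j < m) sym_vec (nabla x (tnth e j)) * K^`M(j).

Definition killing_op (nabla : {bilinear V -> V -> V}) (K : {mpoly R[m]})
    : {mpoly R[m]} :=
  \sum_(i < m) sym_vec (tnth e i) * sym_nabla nabla (tnth e i) K.

Definition is_killing (nabla : {bilinear V -> V -> V}) (K : {mpoly R[m]})
    : Prop := killing_op nabla K = 0.

End SymmetricAlgebra.

(* Sym^k, with Sym^k = 0 for k < 0. *)
Definition in_Sym (R : realType) (m : nat) (k : int) (K : {mpoly R[m]}) : bool :=
  match k with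
  | Posz d => K \is d.-homog
  | Negz _ => K == 0
  end.

(* An orthonormal basis h_1, ..., h_n of the ideal is completed by b as its last
   vector, so that [mwiden], which sends 'X_i to 'X_i and leaves the last
   indeterminate out, is the inclusion of the symmetric algebra of the ideal. *)
Section AlmostAbelian.
Variables (R : realType) (V : vectType R) (g : {dot V for @idfun R}).
Variables (n : nat) (b : V) (hs : n.-tuple V).

Definition frame : (n.+1).-tuple V := [tuple of rcons hs b].

Definition sym_b : {mpoly R[n.+1]} := sym_vec g frame b.

Definition sym_L : {mpoly R[n.+1]} :=
  sym_b * sym_b
  + \sum_(i < n) sym_vec g frame (tnth hs i) * sym_vec g frame (tnth hs i).

Definition odd_part (r : nat) (alpha : 'I_r.+1 -> {mpoly R[n]})
    : {mpoly R[n.+1]} :=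
  sym_b * \sum_(i < r.+1) sym_L ^+ i * mwiden (alpha i).

Definition even_part (r : nat) (beta : 'I_r.+1 -> {mpoly R[n]})
    : {mpoly R[n.+1]} :=
  \sum_(i < r.+1) sym_L ^+ i * mwiden (beta i).

End AlmostAbelian.

Section Facts.
Variables (R : realType) (V : vectType R) (g : {dot V for @idfun R}).
Variables (m : nat) (e : m.-tuple V).
Hypothesis e_onb : is_orthonormal_basis g fullv e.

Lemma dotC u v : g u v = g v u.
Proof. by rewrite hermC expr0 mul1r. Qed.

Lemma dot_eq u v : (forall z, g u z = g v z) -> u = v.
Proof.
move=> eq_uv; apply/eqP; rewrite -subr_eq0; apply: contraT => nz.
have := @neq0_dnorm_gt0 _ _ _ g _ nz.
by rewrite linearBl /= eq_uv subrr ltxx.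
Qed.

Lemma onb_sum v : v = \sum_(i < m) g v (tnth e i) *: tnth e i.
Proof.
have [eB eO] := e_onb.
have := coord_basis eB (memvf v) => {1 2}->.
apply: eq_bigr => j _; congr (_ *: _); last by rewrite (tnth_nth 0).
rewrite linear_sumlz /= (bigD1 j) //= big1 => [|k kj].
  by rewrite linearZl_LR /= -(tnth_nth 0) eO eqxx mulr1 addr0.
by rewrite linearZl_LR /= -(tnth_nth 0) eO (negPf kj) mulr0.
Qed.

Lemma dot_sum u v : g u v = \sum_(i < m) g u (tnth e i) * g v (tnth e i).
Proof.
rewrite {1}(onb_sum v) linear_sumr /=.
by apply: eq_bigr => i _; rewrite linearZr_LR /= mulrC.
Qed.

Lemma levi_civita_unique br nabla nabla' :
  is_levi_civita br g nabla -> is_levi_civita br g nabla' ->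
  forall x y, nabla x y = nabla' x y.
Proof.
move=> [T1 M1] [T2 M2].
pose d x y z := g (nabla x y) z - g (nabla' x y) z.
have dS x y z : d x y z = d y x z.
  have := T1 x y; rewrite -(T2 x y) => /(congr1 (g^~ z)).
  by rewrite !linearBl /d /= => E; lra.
have dA x y z : d x y z = - d x z y.
  have := M1 x y z; have := M2 x y z.
  by rewrite (dotC y) (dotC y (nabla x z)) /d => A B; lra.
move=> x y; apply: dot_eq => z.
have H : d x y z = - d x y z.
  by rewrite {1}dA dS dA dS dA dS opprK.
by move: H; rewrite /d => H; lra.
Qed.

Section Koszul.
Variable br : {bilinear V -> V -> V}.

Definition koszul_form x y z : R :=
  2^-1 * (g (br x y) z - g (br y z) x + g (br z x) y).

Definition koszul (x y : V) : V :=
  \sum_(k < m) koszul_form x y (tnth e k) *: tnth e k.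

Lemma koszul_form_linear x y : linear_for *%R (koszul_form x y).
Proof.
move=> a u v; rewrite /koszul_form.
by rewrite !(linearPr, linearPl) /=; ring.
Qed.

Lemma koszul_bilinear : bilinear_for *:%R *:%R koszul.
Proof.
split=> [y a u v|x a u v]; rewrite /koszul /= scaler_sumr -big_split;
  apply: eq_bigr => k _ /=; rewrite scalerA -scalerDl; congr (_ *: _);
  rewrite /koszul_form !(linearPr, linearPl) /=; ring.
Qed.

Lemma dot_koszul x y z : g (koszul x y) z = koszul_form x y z.
Proof.
rewrite /koszul linear_sumlz /= [in RHS](onb_sum z).
elim/big_rec2: _ => [|k u v _ ->].
  by have := koszul_form_linear x y (-1) 0 0; rewrite scaler0 addr0 => ->; lra.
by rewrite koszul_form_linear linearZl_LR /= (dotC z) mulrC.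
Qed.

Lemma levi_civita_exists : is_lie_bracket br ->
  exists nabla : {bilinear V -> V -> V}, is_levi_civita br g nabla.
Proof.
move=> [alt _].
have anti x y : br x y = - br y x.
  have := alt (x + y); rewrite linearDl !linearDr /= !alt add0r addr0.
  by move/eqP; rewrite addr_eq0 => /eqP.
pose nabla : {bilinear V -> V -> V} := HB.pack koszul
  (bilinear_isBilinear.Build R V V V *:%R *:%R koszul koszul_bilinear).
exists nabla; rewrite /nabla; split=> /= [x y|x y z].
  apply: dot_eq => z; rewrite linearBl /= !dot_koszul /koszul_form.
  rewrite (anti y x) (anti x z) (anti z y) !linearNl /=.
  by lra.
rewrite (dotC y) !dot_koszul /koszul_form.
rewrite (anti z x) (anti y x) (anti z y) !linearNl /=.
by lra.
Qed.

End Koszul.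

Lemma sym_vec_basis i : sym_vec g e (tnth e i) = 'X_i.
Proof.
have [_ eO] := e_onb.
rewrite /sym_vec (bigD1 i) //= big1 => [|k ki]; first by rewrite eO eqxx scale1r addr0.
by rewrite eO eq_sym (negPf ki) scale0r.
Qed.

Lemma sym_nabla_vec nabla x v :
  sym_nabla g e nabla x (sym_vec g e v) = sym_vec g e (nabla x v).
Proof.
have dv j : (sym_vec g e v)^`M(j) = (g v (tnth e j))%:MP_[m].
  rewrite /sym_vec raddf_sum /= (bigD1 j) //= big1 => [|i ij].
    rewrite addr0 mderivZ mderivX mnm1E eqxx scale1r.
    have -> : (U_(j) - U_(j))%MM = 0%MM :> 'X_{1..m}.
      by apply/mnmP => k; rewrite mnmBE subnn mnm0E.
    by rewrite mpolyX0 -mul_mpolyC mulr1.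
  by rewrite mderivZ mderivX mnm1E (negPf ij) scale0r scaler0.
rewrite {2}(onb_sum v) linear_sumr /= /sym_nabla.
transitivity (\sum_(j < m) g v (tnth e j) *: sym_vec g e (nabla x (tnth e j))).
  by apply: eq_bigr => j _; rewrite dv mulrC mul_mpolyC.
transitivity (\sum_(j < m) \sum_(i < m)
    (g v (tnth e j) * g (nabla x (tnth e j)) (tnth e i)) *: 'X_i : {mpoly R[m]}).
  apply: eq_bigr => j _; rewrite /sym_vec scaler_sumr.
  by apply: eq_bigr => i _; rewrite scalerA.
rewrite exchange_big /=; apply: eq_bigr => i _.
rewrite linear_sumlz scaler_suml; apply: eq_bigr => j _.
by rewrite linearZr_LR linearZl_LR.
Qed.

Lemma sym_nablaM nabla x (K1 K2 : {mpoly R[m]}) :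
  sym_nabla g e nabla x (K1 * K2) =
  sym_nabla g e nabla x K1 * K2 + K1 * sym_nabla g e nabla x K2.
Proof.
rewrite /sym_nabla mulr_suml mulr_sumr -big_split; apply: eq_bigr => j _ /=.
by rewrite mderivM; ring.
Qed.

End Facts.

Section AlmostAbelianFacts.
Variables (R : realType) (V : vectType R) (g : {dot V for @idfun R}).
Variables (br : {bilinear V -> V -> V}) (h : {vspace V}).
Variables (n : nat) (b : V) (hs : n.-tuple V).
Hypothesis h_ideal : is_codim1_abelian_ideal br h.
Hypotheses (b_perp : {in h, forall x, g b x = 0}) (b_unit : g b b = 1).
Hypothesis hs_onb : is_orthonormal_basis g h hs.

Lemma tnth_frame_widen i : tnth (frame b hs) (widen_ord (leqnSn n) i) = tnth hs i.
Proof. by rewrite !(tnth_nth 0) /= nth_rcons size_tuple ltn_ord. Qed.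

Lemma tnth_frame_max : tnth (frame b hs) ord_max = b.
Proof. by rewrite (tnth_nth 0) /= nth_rcons size_tuple ltnn eqxx. Qed.

Lemma frame_onb : is_orthonormal_basis g fullv (frame b hs).
Proof.
have [hsB hsO] := hs_onb.
have hs_h i : tnth hs i \in h by rewrite (basis_mem hsB) // mem_tnth.
have gO i j : g (tnth (frame b hs) i) (tnth (frame b hs) j) = (i == j)%:R.
  have cs (k : 'I_n.+1) :
      k = ord_max \/ exists k' : 'I_n, k = widen_ord (leqnSn n) k'.
    have [kn|kn] := ltnP k n; [right; exists (Ordinal kn)|left]; apply: val_inj => //.
    by apply/eqP; rewrite eqn_leq kn -ltnS ltn_ord.
  have [->|[i' ->]] := cs i; have [->|[j' ->]] := cs j.
  - by rewrite tnth_frame_max b_unit eqxx.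
  - rewrite tnth_frame_max tnth_frame_widen b_perp // -val_eqE /=.
    by rewrite gtn_eqF.
  - rewrite tnth_frame_max tnth_frame_widen (dotC g) b_perp // -val_eqE /=.
    by rewrite ltn_eqF.
  - by rewrite !tnth_frame_widen hsO.
split=> //; rewrite basisEfree subvf /=.
rewrite (ideal_codim1 h_ideal) (vector.size_basis hsB) size_rcons size_tuple leqnn andbT.
apply/freeP => c c0 i.
have := congr1 (g^~ (tnth (frame b hs) i)) c0.
rewrite linear0l linear_sumlz /= (bigD1 i) //= big1 => [|k ki].
  by rewrite linearZl_LR /= -(tnth_nth 0 (frame b hs)) gO eqxx mulr1 addr0.
by rewrite linearZl_LR /= -(tnth_nth 0 (frame b hs)) gO (negPf ki) mulr0.
Qed.

Lemma mwiden_sym_vec i :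
  mwiden 'X_i = sym_vec g (frame b hs) (tnth hs i) :> {mpoly R[n.+1]}.
Proof. by rewrite -tnth_frame_widen (sym_vec_basis frame_onb) mwidenX mnmwiden1. Qed.

Lemma sym_bE : sym_b g b hs = 'X_ord_max.
Proof. by rewrite /sym_b -{2}tnth_frame_max (sym_vec_basis frame_onb). Qed.

End AlmostAbelianFacts.

(* Main.v *)
Require Import Defs.
From HB Require Import structures.
From mathcomp Require Import all_boot all_order all_algebra.
From mathcomp Require Import sesquilinear.
From mathcomp Require Import reals.
From mathcomp Require Import mpoly.
From mathcomp Require Import ring lra.

Set Implicit Arguments.
Unset Strict Implicit.
Unset Printing Implicit Defensive.

Import Order.TTheory GRing.Theory Num.Theory.
Local Open Scope ring_scope.

(* In the Killing operator d = sum_(i, j) e_i . nabla_(e_i) e_j . d/de_j the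
   connection may be replaced by the bracket, the difference being killed by
   symmetrization. For an almost abelian algebra this gives
     d = b . delta - Q . d/db,
   where delta is the derivation of Sym(h) extending D and Q is the quadratic
   form x |-> g(D x, x), which vanishes iff D is skew-symmetric. Moreover
   d(L) = 0, so d(sum_i L^i beta_i) = b . sum_i L^i . delta(beta_i), and (1)
   follows since the powers of L are independent over Sym(h). If Q = 0 then
   d(b) = 0, and (2) reduces to (1). If Q <> 0, write P in ker d as
   sum_k P_k b^k; comparing the coefficients of b^k in d(P) = 0 gives
   delta(P_(k-1)) = (k + 1) Q . P_(k+1), so that P_0 = 0 forces P = 0. *)

Lemma mwiden_sum (A : nzRingType) n (I : Type) (s : seq I) (F : I -> {mpoly A[n]}) :
  mwiden (\sum_(i <- s) F i) = \sum_(i <- s) mwiden (F i).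
Proof. exact: (big_morph _ (@mwidenD n A) (mwiden0 n A)). Qed.

Lemma mpolyX_neq0 (R : nzRingType) m (i : 'I_m) : 'X_i != 0 :> {mpoly R[m]}.
Proof. by rewrite -msize_poly_eq0 msizeX. Qed.

(** * Polynomials in [n.+1] variables as univariate polynomials in the last one, which stands for
    $b$ *)

Section Muni.
Variables (R : comNzRingType) (n : nat).
Implicit Types (P : {mpoly R[n.+1]}) (m : 'X_{1..n}).

Let widen : 'I_n -> 'I_n.+1 := widen_ord (leqnSn n).

Lemma mnm_rcons_widen m k (i : 'I_n) : [multinom of rcons m k] (widen i) = m i.
Proof.
by rewrite multinomE (tnth_nth 0%N) /= nth_rcons size_tuple ltn_ord (mnm_nth 0%N).
Qed.

Lemma mnm_rcons_max m k : [multinom of rcons m k] ord_max = k.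
Proof. by rewrite multinomE (tnth_nth 0%N) /= nth_rcons size_tuple ltnn eqxx. Qed.

Lemma ord_max_or_widen (i : 'I_n.+1) : i = ord_max \/ exists j, i = widen j.
Proof.
have [lt_in|le_ni] := ltnP i n; first by right; exists (Ordinal lt_in); apply: val_inj.
by left; apply: val_inj; apply/eqP; rewrite eqn_leq le_ni -ltnS ltn_ord.
Qed.

(** Turns every identity about [muni] below into a comparison of monomial coefficients. *)
Lemma coef_muni P k m : ((muni P)`_k)@_m = P@_[multinom of rcons m k].
Proof.
rewrite muniE coef_sum raddf_sum /= [in RHS](mpolyE P) raddf_sum /=.
apply: eq_bigr => u _; rewrite mcoeffZ mcoeffX coefZ coefXn.
have -> : (u == [multinom of rcons m k]) =
    ([multinom u (widen i) | i < n] == m) && (k == u ord_max).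
  apply/eqP/andP => [->|[/eqP <- /eqP ->]].
    split; last by rewrite mnm_rcons_max.
    by apply/eqP/mnmP => i; rewrite mnmE mnm_rcons_widen.
  apply/mnmP => i; have [->|[j ->]] := ord_max_or_widen i.
    by rewrite mnm_rcons_max.
  by rewrite mnm_rcons_widen mnmE.
case: (k == _); rewrite ?(mulr1, andbT, andbF, mulr0, mcoeff0) //.
by rewrite mcoeffZ mcoeffX.
Qed.

Lemma muni_inj : injective (@muni n R).
Proof.
move=> P P' eqPP'; apply/mpolyP => u.
have -> : u = [multinom of rcons [multinom u (widen i) | i < n] (u ord_max)].
  apply/mnmP => i; have [->|[j ->]] := ord_max_or_widen i.
    by rewrite mnm_rcons_max.
  by rewrite mnm_rcons_widen mnmE.
by rewrite -!coef_muni eqPP'.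
Qed.

Lemma muni_mderiv_widen P (j : 'I_n) :
  muni P^`M(widen j) = map_poly (mderiv j) (muni P).
Proof.
apply/polyP => k; apply/mpolyP => m; rewrite coef_map_id0 ?mderiv0 //.
rewrite mcoeff_mderiv !coef_muni mcoeff_mderiv mnm_rcons_widen.
congr (P@_ _ *+ _); apply/mnmP => i; rewrite mnmDE mnm1E.
have [->|[l ->]] := ord_max_or_widen i.
  by rewrite !mnm_rcons_max -val_eqE /= ltn_eqF ?addn0.
by rewrite !mnm_rcons_widen mnmDE mnm1E.
Qed.

Lemma muni_mderiv_max P : muni P^`M(ord_max) = (muni P)^`().
Proof.
apply/polyP => k; apply/mpolyP => m; rewrite coef_deriv mcoeffMn.
rewrite !coef_muni mcoeff_mderiv mnm_rcons_max.
congr (P@_ _ *+ _); apply/mnmP => i; rewrite mnmDE mnm1E.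
have [->|[l ->]] := ord_max_or_widen i.
  by rewrite !mnm_rcons_max eqxx addn1.
by rewrite !mnm_rcons_widen -val_eqE /= gtn_eqF ?addn0.
Qed.

Lemma muniXmax : muni 'X_ord_max = 'X :> {poly {mpoly R[n]}}.
Proof.
apply/polyP => k; apply/mpolyP => m; rewrite coef_muni coefX mcoeffX.
have -> : (U_(ord_max)%MM == [multinom of rcons m k]) = (m == 0%MM) && (k == 1%N).
  apply/eqP/andP => [/mnmP eqU|[/eqP -> /eqP ->]].
    split; last by have := eqU ord_max; rewrite mnm_rcons_max mnm1E eqxx => <-.
    apply/eqP/mnmP => i; have := eqU (widen i).
    by rewrite mnm_rcons_widen mnm1E -val_eqE /= gtn_eqF // mnm0E.
  apply/mnmP => i; have [->|[j ->]] := ord_max_or_widen i.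
    by rewrite mnm_rcons_max mnm1E eqxx.
  by rewrite mnm_rcons_widen mnm1E -val_eqE /= gtn_eqF // mnm0E.
by case: (k == 1%N); rewrite ?andbT ?andbF ?mcoeff0 // mcoeff1.
Qed.

Lemma muni_mwiden (c : {mpoly R[n]}) : muni (mwiden c) = c%:P.
Proof.
apply/polyP => k; apply/mpolyP => m; rewrite coef_muni coefC.
have [->|k_neq0] := eqVneq k 0%N; first exact: mwiden_mnmwiden.
(* For [k] nonzero nothing contributes: every monomial of [mwiden c] has last exponent 0. *)
rewrite mcoeff0 (@mwidenE _ _ _ (msize c)) // raddf_sum /= big1 // => u _.
rewrite mcoeffZ mcoeffX; case: eqP => [/(congr1 (fun v : 'X_{1..n.+1} => v ord_max))|_].
  by rewrite mnmwiden_ordmax mnm_rcons_max => k0; rewrite -k0 eqxx in k_neq0.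
by rewrite mulr0.
Qed.

End Muni.

(** Exchanging the two sums shows that the total is its own opposite, and 2 is invertible. *)
Lemma anti_sum_eq0 (R : numFieldType) (W : lmodType R) (I : finType) (F : I -> I -> W) :
  (forall i j, F i j = - F j i) -> \sum_i \sum_j F i j = 0.
Proof.
move=> antiF; set s := \sum_i _.
have sN : s = - s.
  rewrite /s {1}exchange_big -sumrN /=; apply: eq_bigr => i _.
  by rewrite -sumrN; apply: eq_bigr.
have : 2%:R *: s = 0 by rewrite scaler_nat mulr2n {1}sN addNr.
by move/eqP; rewrite scaler_eq0 pnatr_eq0 => /eqP.
Qed.

(** The sum is the polynomial with coefficients [c] composed with [q]; over a domain, composition
    with a nonconstant polynomial is injective. *)
Lemma sum_expM_eq0 (A : idomainType) (q : {poly A}) (s : nat) (c : 'I_s -> A) :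
  (1 < size q)%N -> \sum_(i < s) q ^+ i * (c i)%:P = 0 -> forall i, c i = 0.
Proof.
move=> q_gt1 sum0 i.
have /eqP : (\sum_(k < s) (c k)%:P * 'X^k) \Po q = 0.
  rewrite -[RHS]sum0 raddf_sum; apply: eq_bigr => k _ /=.
  by rewrite comp_polyM comp_polyC comp_Xn_poly mulrC.
rewrite comp_poly_eq0 // => /eqP/(congr1 (fun P : {poly A} => P`_i)).
rewrite coef0 coef_sum (bigD1 i) //= big1 => [|k ki].
  by rewrite coefCM coefXn eqxx mulr1 addr0.
by rewrite coefCM coefXn eq_sym -val_eqE /= in ki *; rewrite (negPf ki) mulr0.
Qed.

Lemma lie_anti (R : realType) (V : vectType R) (br : {bilinear V -> V -> V}) :
  is_lie_bracket br -> forall x y, br x y = - br y x.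
Proof.
move=> [alt _] x y; apply/eqP; rewrite -addr_eq0; have := alt (x + y).
by rewrite linearDl !linearDr /= !alt add0r addr0 => ->.
Qed.

(** * The Killing operator of a Lie algebra with inner product, as a derivation *)

Section KillingOperator.
Variables (R : realType) (V : vectType R) (g : {dot V for @idfun R}).
Variables (m : nat) (e : m.-tuple V) (br nabla : {bilinear V -> V -> V}).

Lemma sym_vecD u v : sym_vec g e (u + v) = sym_vec g e u + sym_vec g e v.
Proof.
rewrite /sym_vec -[RHS]big_split; apply: eq_bigr => i _ /=.
by rewrite linearDl scalerDl.
Qed.

Lemma sym_vecN v : sym_vec g e (- v) = - sym_vec g e v.
Proof.
by rewrite /sym_vec -sumrN; apply: eq_bigr => i _; rewrite linearNl scaleNr.
Qed.

Lemma sym_vec0 : sym_vec g e 0 = 0.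
Proof. by rewrite /sym_vec big1 // => i _; rewrite linear0l scale0r. Qed.

Lemma killing_op0 : killing_op g e nabla 0 = 0.
Proof.
by rewrite /killing_op big1 // => i _; rewrite /sym_nabla big1 ?mulr0 // => j _;
  rewrite mderiv0 mulr0.
Qed.

Lemma killing_opD P Q :
  killing_op g e nabla (P + Q) = killing_op g e nabla P + killing_op g e nabla Q.
Proof.
rewrite /killing_op -big_split; apply: eq_bigr => i _ /=.
rewrite -mulrDr /sym_nabla -big_split; congr (_ * _).
by apply: eq_bigr => j _ /=; rewrite mderivD mulrDr.
Qed.

Lemma killing_opM P Q : killing_op g e nabla (P * Q) =
  killing_op g e nabla P * Q + P * killing_op g e nabla Q.
Proof.
rewrite /killing_op mulr_suml mulr_sumr -big_split; apply: eq_bigr => i _ /=.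
by rewrite sym_nablaM; ring.
Qed.

Lemma killing_op_sum (I : Type) (s : seq I) (F : I -> {mpoly R[m]}) :
  killing_op g e nabla (\sum_(i <- s) F i) =
  \sum_(i <- s) killing_op g e nabla (F i).
Proof. exact: (big_morph _ killing_opD killing_op0). Qed.

Lemma killing_op_expM_eq0 P Q i : killing_op g e nabla P = 0 ->
  killing_op g e nabla (P ^+ i * Q) = P ^+ i * killing_op g e nabla Q.
Proof.
move=> P0; elim: i => [|i IHi]; first by rewrite !expr0 !mul1r.
by rewrite exprS -!mulrA killing_opM P0 IHi mul0r add0r.
Qed.

Hypothesis e_onb : is_orthonormal_basis g fullv e.
Hypothesis nabla_lc : is_levi_civita br g nabla.

(* [nabla_i e_j = nabla_j e_i + [e_i, e_j]], and [sum_i e_i . nabla_j e_i] is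
   zero, being half of the derivative of the metric. *)
Lemma killing_opE K : killing_op g e nabla K =
  \sum_(j < m) (\sum_(i < m) 'X_i * sym_vec g e (br (tnth e i) (tnth e j))) * K^`M(j).
Proof.
have [tor met] := nabla_lc.
have anti x : \sum_(i < m) 'X_i * sym_vec g e (nabla x (tnth e i)) = 0.
  rewrite -[RHS](@anti_sum_eq0 R _ _ (fun i k =>
    g (nabla x (tnth e i)) (tnth e k) *: ('X_i * 'X_k : {mpoly R[m]}))).
    apply: eq_bigr => i _; rewrite /sym_vec mulr_sumr.
    by apply: eq_bigr => k _; rewrite -scalerAr.
  move=> i k; rewrite mulrC -scaleNr; congr (_ *: _).
  by have := met x (tnth e i) (tnth e k); rewrite (dotC g (tnth e i)); lra.
rewrite /killing_op /sym_nabla.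
under eq_bigr do rewrite mulr_sumr.
rewrite exchange_big; apply: eq_bigr => j _ /=.
under eq_bigr do rewrite mulrA.
rewrite -mulr_suml; congr (_ * _).
rewrite -[RHS]addr0 -[X in _ + X](anti (tnth e j)) -big_split.
apply: eq_bigr => i _ /=.
by rewrite (sym_vec_basis e_onb) -mulrDr -sym_vecD -tor subrK.
Qed.

(** By the derivation rule the value is $2\sum_{i,j} e_i e_j [e_i,e_j]$, whose summand is
    antisymmetric in $i,j$. *)
Lemma killing_op_metric : is_lie_bracket br ->
  killing_op g e nabla (\sum_(i < m) 'X_i * 'X_i) = 0.
Proof.
move=> br_lie; have dX j : killing_op g e nabla 'X_j =
    \sum_(i < m) 'X_i * sym_vec g e (br (tnth e i) (tnth e j)).
  rewrite killing_opE (bigD1 j) //= [X in _ + X]big1 => [|i ij].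
    rewrite mderivX mnm1E eqxx scale1r addr0.
    by rewrite -[X in 'X_[X - _]]add0m addmK mpolyX0 mulr1.
  by rewrite mderivX mnm1E eq_sym (negPf ij) scale0r mulr0.
rewrite killing_op_sum.
transitivity (\sum_(j < m) \sum_(i < m)
    (2%:R * ('X_i * 'X_j * sym_vec g e (br (tnth e i) (tnth e j))))).
  apply: eq_bigr => j _; rewrite killing_opM dX mulr_suml mulr_sumr -big_split.
  by apply: eq_bigr => i _ /=; ring.
apply: anti_sum_eq0 => i j; rewrite (lie_anti br_lie) sym_vecN; ring.
Qed.

End KillingOperator.

(** * The Killing operator of an almost abelian Lie algebra *)

Section AlmostAbelianKilling.
Variables (R : realType) (n : nat) (V : vectType R) (br : {bilinear V -> V -> V}).
Hypothesis br_lie : is_lie_bracket br.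
Variables (g : {dot V for @idfun R}) (h : {vspace V}).
Hypothesis h_ideal : is_codim1_abelian_ideal br h.
Variable b : V.
Hypotheses (b_perp : {in h, forall x, g b x = 0}) (b_unit : g b b = 1).
Variable hs : n.-tuple V.
Hypothesis hs_onb : is_orthonormal_basis g h hs.
Variable nabla : {bilinear V -> V -> V}.
Hypothesis nabla_lc : is_levi_civita br g nabla.

Local Notation e := (frame b hs).
Local Notation d := (killing_op g e nabla).
Local Notation widen := (widen_ord (leqnSn n)).

Let e_onb := frame_onb h_ideal b_perp b_unit hs_onb.

(** The quadratic form $Q(x)=g(Dx,x)$ in the coordinates of [hs]. *)
Definition ad_quad : {mpoly R[n]} :=
  \sum_(i < n) 'X_i * sym_vec g hs (br b (tnth hs i)).

(** The derivation $\delta$ of $\mathrm{Sym}(\mathfrak h)$ extending $D$. *)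
Definition ad_deriv (c : {mpoly R[n]}) : {mpoly R[n]} :=
  \sum_(j < n) sym_vec g hs (br b (tnth hs j)) * c^`M(j).

Let hs_h i : tnth hs i \in h.
Proof. by rewrite (basis_mem hs_onb.1) // mem_tnth. Qed.

Lemma sym_vec_mwiden v : v \in h -> sym_vec g e v = mwiden (sym_vec g hs v).
Proof.
move=> vh; rewrite /sym_vec big_ord_recr /= tnth_frame_max (dotC g v).
rewrite (b_perp vh) scale0r addr0 mwiden_sum; apply: eq_bigr => i _ /=.
by rewrite tnth_frame_widen mwidenZ mwidenX mnmwiden1.
Qed.

(** As the ideal is abelian, only $[b,h_j]$ and $[h_i,b]$ survive in [killing_opE]. The former give
    the first term; the latter, by antisymmetry, give $-Q$. *)
Lemma killing_op_frame P : d P =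
  'X_ord_max * (\sum_(j < n) mwiden (sym_vec g hs (br b (tnth hs j))) * P^`M(widen j))
  - mwiden ad_quad * P^`M(ord_max).
Proof.
have [alt _] := br_lie; have [stab ab _] := h_ideal.
rewrite (killing_opE e_onb nabla_lc) big_ord_recr /=; congr (_ + _).
  rewrite mulr_sumr; apply: eq_bigr => j _.
  rewrite big_ord_recr /= big1 => [|i _].
    by rewrite add0r tnth_frame_max tnth_frame_widen sym_vec_mwiden ?stab // mulrA.
  by rewrite !tnth_frame_widen ab // sym_vec0 mulr0.
rewrite -mulNr; congr (_ * _); rewrite big_ord_recr /= tnth_frame_max alt sym_vec0.
rewrite mulr0 addr0 /ad_quad mwiden_sum -sumrN; apply: eq_bigr => i _ /=.
rewrite tnth_frame_widen (lie_anti br_lie) sym_vecN sym_vec_mwiden ?stab //.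
by rewrite mwidenM mwidenX mnmwiden1 mulrN.
Qed.

(** Widened factors become constants here, so that $d$ can be studied degree by degree in $b$. *)
Lemma muni_killing_op P : muni (d P) =
  'X * (\sum_(j < n) (sym_vec g hs (br b (tnth hs j)))%:P
          * map_poly (mderiv j) (muni P))
  - ad_quad%:P * (muni P)^`().
Proof.
rewrite killing_op_frame muniB !muniM muniXmax muni_mwiden muni_mderiv_max.
rewrite raddf_sum; congr (_ * _ - _); apply: eq_bigr => j _ /=.
by rewrite muniM muni_mwiden muni_mderiv_widen.
Qed.

Lemma killing_op_mwiden c : d (mwiden c) = 'X_ord_max * mwiden (ad_deriv c).
Proof.
apply: muni_inj; rewrite muni_killing_op !muniM muniXmax !muni_mwiden.
rewrite derivC mulr0 subr0 /ad_deriv raddf_sum; congr (_ * _); apply: eq_bigr => j _ /=.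
by rewrite rmorphM; congr (_ * _); exact: (map_polyC (mderiv j)).
Qed.

Lemma sym_LE : sym_L g b hs = \sum_(i < n.+1) 'X_i * 'X_i.
Proof.
rewrite big_ord_recr /= /sym_L (sym_bE h_ideal b_perp b_unit hs_onb) addrC.
congr (_ + _); apply: eq_bigr => i _.
by rewrite -(mwiden_sym_vec h_ideal b_perp b_unit hs_onb) mwidenX mnmwiden1.
Qed.

Lemma killing_op_even_part r (beta : 'I_r.+1 -> {mpoly R[n]}) :
  d (even_part g b hs beta) =
  'X_ord_max * \sum_(i < r.+1) sym_L g b hs ^+ i * mwiden (ad_deriv (beta i)).
Proof.
rewrite /even_part killing_op_sum mulr_sumr; apply: eq_bigr => i _.
rewrite killing_op_expM_eq0; first by rewrite killing_op_mwiden mulrCA.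
by rewrite sym_LE (killing_op_metric e_onb nabla_lc br_lie).
Qed.

(** As a polynomial in $b$, $L$ is $b^2$ plus a constant, hence nonconstant, and [sum_expM_eq0]
    applies. *)
Lemma sum_sym_L_eq0 r (c : 'I_r.+1 -> {mpoly R[n]}) :
  \sum_(i < r.+1) sym_L g b hs ^+ i * mwiden (c i) = 0 -> forall i, c i = 0.
Proof.
move=> /(congr1 (@muni n R)); rewrite raddf_sum muni0 /=.
have -> : \sum_(i < r.+1) muni (sym_L g b hs ^+ i * mwiden (c i)) =
    \sum_(i < r.+1) ('X^2 + (\sum_(k < n) 'X_k * 'X_k)%:P) ^+ i * (c i)%:P.
  apply: eq_bigr => i _; rewrite muniM muni_mwiden rmorphXn /=; congr (_ ^+ i * _).
  rewrite sym_LE big_ord_recr /= muniD muniM muniXmax addrC; congr (_ + _).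
  rewrite -muni_mwiden; congr muni; rewrite mwiden_sum; apply: eq_bigr => k _ /=.
  by rewrite mwidenM mwidenX mnmwiden1.
apply: sum_expM_eq0; rewrite size_polyDl size_polyXn //.
by rewrite ltnS size_polyC; case: (_ != 0).
Qed.

Lemma killing_even_part r (beta : 'I_r.+1 -> {mpoly R[n]}) :
  is_killing g e nabla (even_part g b hs beta) <->
  forall i, is_killing g e nabla (mwiden (beta i)).
Proof.
rewrite /is_killing killing_op_even_part; split=> [/eqP|killing_beta].
  rewrite mulf_eq0 (negPf (mpolyX_neq0 _ _)) /= => /eqP/sum_sym_L_eq0 ad0 i.
  by rewrite killing_op_mwiden ad0 mwiden0 mulr0.
rewrite mulr_sumr big1 // => i _.
by rewrite mulrCA -killing_op_mwiden killing_beta mulr0.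
Qed.

Lemma ad_quad_eq0 : is_skew_on g h (br b) <-> ad_quad = 0.
Proof.
split=> [skew|quad0].
  rewrite -[RHS](@anti_sum_eq0 R _ _ (fun i k =>
    g (br b (tnth hs i)) (tnth hs k) *: ('X_i * 'X_k : {mpoly R[n]}))).
    apply: eq_bigr => i _; rewrite /sym_vec mulr_sumr.
    by apply: eq_bigr => k _; rewrite -scalerAr.
  move=> i k; rewrite mulrC -scaleNr; congr (_ *: _).
  by rewrite skew // (dotC g).
(* Evaluating [ad_quad] at the coordinates of [x] gives $g(Dx,x)$. *)
have quad x : x \in h -> g (br b x) x = 0.
  move=> xh; pose a i := coord hs i x.
  have xE : x = \sum_(i < n) a i *: tnth hs i.
    rewrite {1}(coord_basis hs_onb.1 xh).
    by apply: eq_bigr => i _; rewrite (tnth_nth 0).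
  have eval_ad v : (sym_vec g hs v).@[a] = g v x.
    rewrite xE linear_sumr raddf_sum /=; apply: eq_bigr => k _.
    by rewrite linearZr_LR /= mevalZ mevalXU mulrC.
  have brE : br b x = \sum_(i < n) a i *: br b (tnth hs i).
    by rewrite xE linear_sumr; apply: eq_bigr => i _; rewrite linearZr_LR.
  have := congr1 (meval a) quad0; rewrite meval0 => <-.
  rewrite brE linear_sumlz raddf_sum /=; apply: eq_bigr => i _.
  by rewrite linearZl_LR /= mevalM mevalXU eval_ad.
(* Polarization: expand $g(D(x+y),x+y)=0$. *)
move=> x y xh yh; have := quad _ (memvD xh yh).
by rewrite !linearDr !linearDl /= (quad x) // (quad y) // (dotC g x) => ?; lra.
Qed.

Lemma killing_muni0_eq0 P : ad_quad != 0 -> d P = 0 -> (muni P)`_0 = 0 -> P = 0.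
Proof.
move=> quad_neq0 dP0 P0; apply: muni_inj; rewrite muni0; apply/polyP => k.
rewrite coef0.
(* The recursion links coefficients two degrees apart, so the induction carries two consecutive
   ones. *)
suff: (muni P)`_k = 0 /\ (muni P)`_k.+1 = 0 by case.
(* In degree [k'] the equation reads: this sum equals [k'.+1] times $Q\,P_{k'+1}$. Both $Q$ and
   [k'.+1] can be cancelled. *)
have next k' : \sum_(j < n) sym_vec g hs (br b (tnth hs j)) *
    ('X * map_poly (mderiv j) (muni P))`_k' = 0 -> (muni P)`_k'.+1 = 0.
  move=> sum0; have /(congr1 (fun F : {poly {mpoly R[n]}} => F`_k')) :=
    muni_killing_op P.
  rewrite dP0 muni0 coef0 coefB mulr_sumr coef_sum.
  under eq_bigr do rewrite mulrCA coefCM.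
  rewrite sum0 sub0r coefCM coef_deriv => /esym/eqP.
  rewrite oppr_eq0 mulf_eq0 (negPf quad_neq0) /=.
  by rewrite -scaler_nat scaler_eq0 pnatr_eq0 => /eqP.
elim: k => [|k [Pk PSk]].
  (* $P_1=0$ because $b\cdot\delta(P)$ has no term of degree 0 in $b$. *)
  by split=> //; apply: next; rewrite big1 // => j _; rewrite coefXM mulr0.
split=> //; apply: next; rewrite big1 // => j _.
by rewrite coefXM /= coef_map_id0 ?mderiv0 // Pk mderiv0 mulr0.
Qed.

End AlmostAbelianKilling.

Theorem theorem4p5 (R : realType) (n : nat) (V : vectType R)
    (br : {bilinear V -> V -> V}) (br_lie : is_lie_bracket br)
    (dimV : \dim {:V} = n.+1)
    (g : {dot V for @idfun R})
    (h : {vspace V}) (h_ideal : is_codim1_abelian_ideal br h)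
    (b : V) (b_perp : {in h, forall x, g b x = 0}) (b_unit : g b b = 1)
    (hs : n.-tuple V) (hs_onb : is_orthonormal_basis g h hs)
    (nabla : {bilinear V -> V -> V}) (nabla_lc : is_levi_civita br g nabla)
    (p : nat) (K : {mpoly R[n.+1]}) (K_sym : in_Sym p%:Z K)
    (alpha beta : 'I_(p./2).+1 -> {mpoly R[n]})
    (alpha_sym : forall i : 'I_(p./2).+1,
       in_Sym (p%:Z - (2 * i)%N%:Z - 1) (alpha i))
    (beta_sym : forall i : 'I_(p./2).+1,
       in_Sym (p%:Z - (2 * i)%N%:Z) (beta i))
    (K_dec : K = \sum_(i < (p./2).+1)
       sym_L g b hs ^+ i * (mwiden (alpha i) * sym_b g b hs + mwiden (beta i))) :
  let D : V -> V := br b in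
  let Killing := is_killing g (frame b hs) nabla in
  let Ko := odd_part g b hs alpha in
  let Ke := even_part g b hs beta in
  [/\ Killing Ke <-> (forall i, Killing (mwiden (beta i))),
      is_skew_on g h D ->
        (Killing Ko <-> (forall i, Killing (mwiden (alpha i)))) &
      ~ is_skew_on g h D -> (Killing Ko <-> Ko = 0)].
Proof.
move=> D Killing Ko Ke.
have even := @killing_even_part R n V br br_lie g h h_ideal b b_perp b_unit hs
  hs_onb nabla nabla_lc p./2.
have bE : sym_b g b hs = 'X_ord_max := sym_bE h_ideal b_perp b_unit hs_onb.
have KoE : Ko = 'X_ord_max * even_part g b hs alpha by rewrite /Ko /odd_part bE.
have quadP := ad_quad_eq0 br b hs_onb.
split=> [|/quadP quad0|not_skew]; first exact: even.
  (* The $\delta$ term vanishes since $b$ does not involve the $h_j$, the other one since $Q=0$. *)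
  have db0 : killing_op g (frame b hs) nabla 'X_ord_max = 0.
    apply: muni_inj; rewrite (muni_killing_op br_lie h_ideal) // quad0 muniXmax.
    rewrite mul0r subr0 muni0 big1 ?mulr0 // => j _.
    rewrite (_ : map_poly _ _ = 0) ?mulr0 //.
    rewrite -muniXmax -muni_mderiv_widen mderivX mnm1E -val_eqE /= gtn_eqF //.
    by rewrite scale0r muni0.
  (* The first equivalence, applied to [alpha], leaves only the factor $b$ to cancel. *)
  rewrite /Killing -even /is_killing KoE killing_opM db0 mul0r add0r.
  split=> [/eqP|->]; last by rewrite mulr0.
  by rewrite mulf_eq0 (negPf (mpolyX_neq0 _ _)) => /eqP.
split=> [dKo|->]; last exact: killing_op0.
(* $K^o$ is divisible by $b$, so its coefficient of degree 0 in $b$ is zero. *)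
apply: (killing_muni0_eq0 br_lie h_ideal b_perp b_unit hs_onb nabla_lc) => //.
  by apply/eqP => /quadP.
by rewrite KoE muniM muniXmax coefXM.
Qed.
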